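(* Let $X$ be an order continuous rearrangement invariant space with the Fatou property and let $F$ be an Orlicz function. Suppose that the Cesàro operator $C$ is bounded on the Calderón–Lozanovskiĭ space $X_F$. If the Cesàro space $C(X_F)$ contains a lattice isometric copy of $\ell_\infty$, then $X_F$ also contains a lattice isometric copy of $\ell_\infty$.
   Context: Rearrangement invariant spaces are on $(0,1)$, $(0,\infty)$ (Lebesgue measure) or $\mathbb N$ (counting measure): Banach spaces $X\subset L_0$ with the ideal property ($|f|\le|g|$, $g\in X$ imply $f\in X$, $\|f\|_X\le\|g\|_X$), containing an a.e. positive element, with equal norms for equimeasurable elements. Order continuous: for every $f\in X$, $0\le f_n\le|f|$, $f_n\downarrow0$ a.e. imply $\|f_n\|_X\to0$. Fatou property: $0\le f_n\uparrow f$, $\sup\|f_n\|_X<\infty$ imply $f\in X$ and $\|f_n\|_X\uparrow\|f\|_X$. An Orlicz function is a non-decreasing convex $F:[0,\infty)\to[0,\infty]$ with $F(0)=0$; $X_F=\{f:\|f\|_{X_F}<\infty\}$ with $\|f\|_{X_F}=\inf\{\lambda>0:\|F(|f|/\lambda)\|_X\le1\}$. The Cesàro operator is $C(f)(x)=\frac1x\int_0^x|f|$ (function case) or $C(x)_n=\frac1n\sum_{k=1}^nx_k$ (sequence case), and $C(X_F)=\{f:C(|f|)\in X_F\}$ with norm $\|C(|f|)\|_{X_F}$. A lattice isometric copy of $\ell_\infty$ is the image of a linear isometric lattice-homomorphic embedding of $\ell_\infty$. *)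

(* Defs.v *)
From HB Require Import structures.
From mathcomp Require Import all_boot all_order all_algebra.
From mathcomp Require Import all_classical all_reals all_analysis.
Set Implicit Arguments. Unset Strict Implicit. Unset Printing Implicit Defensive.
Import Order.TTheory GRing.Theory Num.Theory.
Import numFieldNormedType.Exports.
Local Open Scope classical_set_scope.
Local Open Scope ring_scope.

Section Generic.
Context {R : realType} {d : measure_display} {T : measurableType d}.
Variable mu : set T -> \bar R.

(* L_0 elements are represented by measurable functions; everything is
   considered modulo mu-a.e. equality. *)
Definition meas (f : T -> R) := measurable_fun setT f.

(* A "norm" on a space X ⊂ L_0 is given as an extended-real functional,
   X = { f measurable | N f < +oo }. *)
Definition in_space (N : (T -> R) -> \bar R) (f : T -> R) :=
  meas f /\ (N f < +oo)%E.

Definition distrib (f : T -> R) (l : R) : \bar R := mu [set x | l < `|f x|].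
Definition equimeasurable (f g : T -> R) :=
  forall l : R, 0 <= l -> distrib f l = distrib g l.

Record ri_space (N : (T -> R) -> \bar R) : Prop := {
  ri_ideal : forall f g, meas f -> meas g ->
     {ae mu, forall x, `|f x| <= `|g x|} -> (N f <= N g)%E ;
  ri_ge0 : forall f, (0 <= N f)%E ;
  ri_definite : forall f, in_space N f -> N f = 0%E ->
     {ae mu, forall x, f x = 0} ;
  ri_homogeneous : forall (a : R) f, in_space N f ->
     N (fun x => a * f x) = (`|a|%:E * N f)%E ;
  ri_triangle : forall f g, in_space N f -> in_space N g ->
     (N (fun x => (f x + g x)%R) <= N f + N g)%E ;
  ri_complete : forall u : nat -> T -> R, (forall n, in_space N (u n)) ->
     (forall e : R, 0 < e -> exists n0 : nat, forall m n, (n0 <= m)%N -> (n0 <= n)%N ->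
        (N (fun x => (u m x - u n x)%R) < e%:E)%E) ->
     exists f, in_space N f /\ N (fun x => u n x - f x) @[n --> \oo] --> 0%E ;
  ri_weak_unit : exists g, in_space N g /\ {ae mu, forall x, 0 < g x} ;
  ri_rearr : forall f g, meas f -> meas g -> equimeasurable f g -> N f = N g
}.

Definition order_continuous (N : (T -> R) -> \bar R) :=
  forall (f : T -> R) (fn : nat -> T -> R), in_space N f ->
    (forall n, meas (fn n)) ->
    {ae mu, forall x, (forall n, 0 <= fn n x <= `|f x| /\ fn n.+1 x <= fn n x)
                      /\ fn ^~ x @ \oo --> 0} ->
    N (fn n) @[n --> \oo] --> 0%E.

Definition fatou_property (N : (T -> R) -> \bar R) :=
  forall (fn : nat -> T -> R) (f : T -> R),
    (forall n, meas (fn n)) -> meas f ->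
    {ae mu, forall x, (forall n, 0 <= fn n x <= fn n.+1 x)
                      /\ fn ^~ x @ \oo --> f x} ->
    (exists M : R, forall n, (N (fn n) <= M%:E)%E) ->
    (N f < +oo)%E /\ N (fn n) @[n --> \oo] --> N f.

(* Calderon-Lozanovskii norm ||f||_{X_F} = inf {l > 0 : ||F(|f|/l)||_X <= 1};
   F(|f|/l) must be an element of L_0 (a.e. finite) for its X-norm to be finite. *)
Definition cl_norm (N : (T -> R) -> \bar R) (F : R -> \bar R) (f : T -> R) : \bar R :=
  ereal_inf [set l%:E | l in [set l : R | 0 < l /\
      {ae mu, forall x, (F (`|f x| / l)%R < +oo)%E} /\
      (N (fun x => fine (F (`|f x| / l)%R)) <= 1)%E]].

(* Cesaro space C(X_F), given the (extended-valued) Cesaro operator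
   Ces f = C(|f|) *)
Definition in_ces_space (N : (T -> R) -> \bar R) (F : R -> \bar R)
    (Ces : (T -> R) -> T -> \bar R) (f : T -> R) :=
  meas f /\ {ae mu, forall x, (Ces f x < +oo)%E} /\
  in_space (cl_norm N F) (fun x => fine (Ces f x)).

Definition ces_norm (N : (T -> R) -> \bar R) (F : R -> \bar R)
    (Ces : (T -> R) -> T -> \bar R) (f : T -> R) : \bar R :=
  cl_norm N F (fun x => fine (Ces f x)).

Definition cesaro_bounded (N : (T -> R) -> \bar R) (F : R -> \bar R)
    (Ces : (T -> R) -> T -> \bar R) :=
  exists M : R, forall f, in_space (cl_norm N F) f ->
    {ae mu, forall x, (Ces f x < +oo)%E} /\
    in_space (cl_norm N F) (fun x => fine (Ces f x)) /\
    (cl_norm N F (fun x => fine (Ces f x)) <= M%:E * cl_norm N F f)%E.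

Definition linf_bounded (a : nat -> R) := exists M : R, forall n, `|a n| <= M.
Definition linf_norm (a : nat -> R) : \bar R :=
  ereal_sup (range (fun n => (`|a n|)%:E)).

Definition contains_lattice_copy_linf (inE : (T -> R) -> Prop)
    (NE : (T -> R) -> \bar R) :=
  exists J : (nat -> R) -> T -> R,
    (forall a, linf_bounded a -> inE (J a) /\ NE (J a) = linf_norm a) /\
    (forall a b, linf_bounded a -> linf_bounded b ->
       {ae mu, forall x, J (fun n => a n + b n) x = J a x + J b x}) /\
    (forall (c : R) a, linf_bounded a ->
       {ae mu, forall x, J (fun n => c * a n) x = c * J a x}) /\
    (forall a b, linf_bounded a -> linf_bounded b ->
       {ae mu, forall x, J (fun n => Num.max (a n) (b n)) x
                         = Num.max (J a x) (J b x)}).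

End Generic.

(* Orlicz function F : [0,oo) -> [0,oo] (values on negative reals irrelevant) *)
Definition orlicz {R : realType} (F : R -> \bar R) :=
  F 0 = 0%E /\
  (forall s t : R, 0 <= s -> s <= t -> (F s <= F t)%E) /\
  (forall s t th : R, 0 <= s -> 0 <= t -> 0 <= th <= 1 ->
     (F (th * s + (1 - th) * t)%R <= th%:E * F s + (1 - th)%R%:E * F t)%E).

Definition thm45_for {R : realType} {d : measure_display} {T : measurableType d}
    (mu : set T -> \bar R) (Ces : (T -> R) -> T -> \bar R) :=
  forall (N : (T -> R) -> \bar R) (F : R -> \bar R),
    ri_space mu N -> order_continuous mu N -> fatou_property mu N ->
    orlicz F -> cesaro_bounded mu N F Ces ->
    contains_lattice_copy_linf mu (in_ces_space mu N F Ces) (ces_norm mu N F Ces) ->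
    contains_lattice_copy_linf mu (in_space (cl_norm mu N F)) (cl_norm mu N F).

Definition leb_on {R : realType} (I : set R) : set (measurableTypeR R) -> \bar R :=
  fun A => lebesgue_measure (A `&` I).

Definition ces_fun {R : realType} (f : measurableTypeR R -> R) (x : measurableTypeR R)
  : \bar R :=
  (x^-1%:E * \int[lebesgue_measure]_(t in `[(0:R)%R, (x:R)]) (`|f t|)%:E)%E.

(* Cesaro operator, sequence case (N = {1,2,...} shifted to nat = {0,1,...}):
   C(|x|)_n = 1/(n+1) sum_{k<=n} |x_k| *)
Definition ces_seq {R : realType} (u : nat -> R) (n : nat) : \bar R :=
  ((n.+1%:R)^-1 * \sum_(k < n.+1) `|u k|)%:E.

(* Main.v *)
(* The argument uses only the Fatou property of X_F and the order continuity of
   X, with no case distinction on the growth of F.  Let J embed l_oo into C(X_F).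
   Subtracting their common limit from the functions C(J(1_{k >= n})) gives
   functions G_n decreasing to 0 with G_n >= C(J(e_n)), so all of them have norm
   exactly 1 in X_F.  An Egorov argument yields sets B_m decreasing to a null set
   off which some G_n is dominated by an arbitrarily small multiple of a fixed
   element of X_F; hence h = G_0 keeps norm 1 on every B_m.  By the Fatou property,
   a gliding hump produces disjoint sets D_j = B_{m_j} \ B_{m_{j+1}} on which the
   norm of h tends to 1.  Splitting the indices j into infinitely many infinite
   classes, the restrictions of h to the unions of the D_j over these classes
   are disjoint, of norm 1, and dominated by h: they span a lattice isometric
   copy of l_oo. *)
Require Import Defs.
From HB Require Import structures.
From mathcomp Require Import all_boot all_order all_algebra.
From mathcomp Require Import all_classical all_reals all_analysis.
From mathcomp Require Import measurable_realfun ring lra.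
From mathcomp Require finmap.
Import Order.TTheory GRing.Theory Num.Theory.
Import numFieldNormedType.Exports.
Local Open Scope classical_set_scope.
Local Open Scope ring_scope.

(** * Orlicz functions: monotonicity, convexity, measurability *)

Section OrliczFunction.
Context {R : realType} {F : R -> \bar R} (FO : orlicz F).

Lemma orlicz_ge0 (s : R) : 0 <= s -> (0 <= F s)%E.
Proof. by case: FO => F0 [Fmono _] s0; rewrite -F0; exact: Fmono. Qed.

Lemma orlicz_fineK (s : R) : 0 <= s -> (F s < +oo)%E -> (fine (F s))%:E = F s.
Proof. by move=> s0 Fs; rewrite fineK// ge0_fin_numE// orlicz_ge0. Qed.

Lemma orlicz_le (s t : R) : 0 <= s -> s <= t -> (F s <= F t)%E.
Proof. by case: FO => _ [Fmono _]; exact: Fmono. Qed.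

Lemma orlicz_fine_le (s t : R) : 0 <= s -> s <= t -> (F t < +oo)%E ->
  fine (F s) <= fine (F t).
Proof.
move=> s0 st Ft; rewrite -lee_fin !orlicz_fineK//; first exact: orlicz_le.
  exact: le_trans st.
exact: le_lt_trans (orlicz_le s t s0 st) Ft.
Qed.

Lemma orlicz_fine_norm (s : R) : 0 <= s -> `|fine (F s)| = fine (F s).
Proof. by move=> s0; rewrite ger0_norm// fine_ge0// orlicz_ge0. Qed.

(** By monotonicity the sublevel sets are intervals. The modulus is there because [F] is
    unconstrained on negative reals. *)
Lemma measurable_orlicz_norm : measurable_fun [set: R] (fun s : R => F `|s|).
Proof.
apply: (measurability _ (ErealGenOInfty.measurableE R)).
move=> /= _ [_ [a ->]] <-; apply: measurableI => //; rewrite preimage_itvoy.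
rewrite -[X in measurable X]setCK; apply: measurableC.
apply: is_interval_measurable => s t /= /negP; rewrite -leNgt => Fs.
move=> /negP; rewrite -leNgt => Ft r /andP[sr rt].
apply/negP; rewrite -leNgt.
have [r0|r0] := leP 0 r.
  apply: le_trans Ft; apply: orlicz_le => //.
  by rewrite !ger0_norm//; exact: le_trans rt.
apply: le_trans Fs; apply: orlicz_le => //.
by rewrite !ler0_norm ?lerN2//; [exact: le_trans (ltW r0) | exact: ltW].
Qed.

Lemma orlicz_shrink (th s : R) : 0 <= s -> 0 <= th <= 1 ->
  (F (th * s)%R <= th%:E * F s)%E.
Proof.
move=> s0 th01; case: FO => F0 [_ Fconv].
by have := Fconv s 0 th s0 (lexx 0) th01; rewrite mulr0 addr0 F0 mule0 adde0.
Qed.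

End OrliczFunction.

(** * The Luxemburg-type norm of the Calderón-Lozanovskii space *)

Section CalderonLozanovskii.
Context {R : realType} {d : measure_display} {T : measurableType d}
  {mu : {measure set T -> \bar R}} {N : (T -> R) -> \bar R} {F : R -> \bar R}.
Hypotheses (riN : ri_space mu N) (FO : orlicz F).

Lemma meas_mul_indic (f : T -> R) (A : set T) : meas f -> measurable A ->
  meas (fun x => f x * \1_A x).
Proof. by move=> mf mA; apply: measurable_funM => //; exact: measurable_indic. Qed.

Lemma meas_orlicz (f : T -> R) (l : R) : 0 < l -> meas f ->
  meas (fun x => fine (F (`|f x| / l)%R)).
Proof.
move=> l0 mf.
have -> : (fun x => fine (F (`|f x| / l)%R)) =
    fine \o ((fun s : R => F `|s|) \o (fun x => f x / l)).
  by apply/funext => x /=; rewrite normrM (gtr0_norm (_ : 0 < l^-1)) ?invr_gt0.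
apply: measurableT_comp; first exact: fine_measurable.
apply: measurableT_comp; first exact: measurable_orlicz_norm.
exact: measurable_funM.
Qed.

(** Membership in the set whose infimum is [cl_norm]. Arguments run on this set itself, since the
    infimum need not be attained. *)
Definition admissible (f : T -> R) (l : R) :=
  0 < l /\ {ae mu, forall x, (F (`|f x| / l)%R < +oo)%E} /\
  (N (fun x => fine (F (`|f x| / l)%R)) <= 1)%E.

Lemma admissible_le (f g : T -> R) (l k : R) : meas f -> meas g -> 0 < k ->
  {ae mu, forall x, `|f x| / k <= `|g x| / l} ->
  admissible g l -> admissible f k.
Proof.
move=> mf mg k0 fg [l0 [gfin Ng]]; split => //; split.
  apply: filterS2 fg gfin => x fgx; apply: le_lt_trans.
  by apply: (orlicz_le FO) => //; rewrite divr_ge0// ltW.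
apply: le_trans Ng; apply: (ri_ideal riN); try exact: meas_orlicz.
apply: filterS2 fg gfin => x fgx gx.
have fk0 : 0 <= `|f x| / k by rewrite divr_ge0// ltW.
have gl0 : 0 <= `|g x| / l by exact: le_trans fgx.
rewrite !(orlicz_fine_norm FO)//.
exact: (orlicz_fine_le FO).
Qed.

(** Admissible scalars are closed upwards ([admissible_le] with both functions equal to [f]). *)
Lemma cl_norm_lt_admissible (f : T -> R) (l : R) : meas f ->
  (cl_norm mu N F f < l%:E)%E -> admissible f l.
Proof.
move=> mf /ereal_inf_lt[_ [k admk <-]]; rewrite lte_fin => kl.
have [k0 _] := admk; have l0 := lt_trans k0 kl.
apply: (admissible_le _ _ _ _ mf mf l0 _ admk); apply: aeW => x.
by rewrite ler_wpM2l// lef_pV2 ?posrE// ltW.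
Qed.

Lemma admissible_cl_norm (f : T -> R) (l : R) : admissible f l ->
  (cl_norm mu N F f <= l%:E)%E.
Proof. by move=> admf; apply: ereal_inf_lbound; exists l. Qed.

Lemma ri_norm0 : N (fun=> 0) = 0%E.
Proof.
have [g [gX _]] := ri_weak_unit riN.
have := ri_homogeneous riN 0 gX; rewrite normr0 mul0e => <-.
by congr N; apply/funext => x; rewrite mul0r.
Qed.

Lemma admissible_ae0 (f : T -> R) (l : R) : meas f -> 0 < l ->
  {ae mu, forall x, f x = 0} -> admissible f l.
Proof.
move=> mf l0 f0; have [F0 _] := FO.
apply: (@admissible_le _ (fun=> 0) l) => //.
- exact: measurable_cst.
- by apply: filterS f0 => x ->.
- split => //; split; first by apply: aeW => x; rewrite normr0 mul0r F0.
  have -> : (fun x : T => fine (F (`|0 : R| / l))) = (fun=> 0).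
    by apply/funext => x; rewrite normr0 mul0r F0.
  by rewrite ri_norm0.
Qed.

(** Triangle inequality: [(f + g) / (l + k)] is the convex combination of [f / l] and [g / k] with
    weight [th = l / (l + k)], and [F] is convex. *)
Lemma admissibleD (f g : T -> R) (l k : R) : meas f -> meas g ->
  admissible f l -> admissible g k -> admissible (fun x => f x + g x) (l + k).
Proof.
move=> mf mg [l0 [ffin Nf]] [k0 [gfin Ng]].
have lk0 : 0 < l + k by rewrite addr_gt0.
pose th := l / (l + k).
have th0 : 0 <= th by rewrite divr_ge0// ltW.
have th1 : th <= 1 by rewrite ler_pdivrMr// mul1r lerDl ltW.
have th'E : 1 - th = k / (l + k).
  by rewrite /th -{1}(divff (lt0r_neq0 lk0)) -mulrBl addrAC subrr add0r.
have th'0 : 0 <= 1 - th by rewrite subr_ge0.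
have F_le x : (F (`|f x + g x| / (l + k))%R <=
    th%:E * F (`|f x| / l)%R + (1 - th)%R%:E * F (`|g x| / k)%R)%E.
  have [_ [_ Fconv]] := FO.
  have fl0 : 0 <= `|f x| / l by rewrite divr_ge0// ltW.
  have gk0 : 0 <= `|g x| / k by rewrite divr_ge0// ltW.
  apply: le_trans (Fconv _ _ th fl0 gk0 _); last by rewrite th0.
  apply: (orlicz_le FO); first by rewrite divr_ge0// ltW.
  rewrite th'E /th.
  have -> : l / (l + k) * (`|f x| / l) + k / (l + k) * (`|g x| / k) =
      (`|f x| + `|g x|) / (l + k).
    by field; rewrite !lt0r_neq0.
  by rewrite ler_pM2r ?invr_gt0// ler_normD.
split => //; split.
  apply: filterS2 ffin gfin => x fx gx; apply: le_lt_trans (F_le x) _.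
  by rewrite lte_add_pinfty// lte_mul_pinfty// ?(orlicz_ge0 FO)// ?divr_ge0// ltW.
set Pf := fun x => fine (F (`|f x| / l)%R); set Pg := fun x => fine (F (`|g x| / k)%R).
have mPf : meas Pf by exact: meas_orlicz.
have mPg : meas Pg by exact: meas_orlicz.
have PfX : in_space N Pf by split => //; apply: le_lt_trans Nf _; rewrite ltry.
have PgX : in_space N Pg by split => //; apply: le_lt_trans Ng _; rewrite ltry.
have homo_le (c : R) (P : T -> R) : 0 <= c -> in_space N P -> (N P <= 1)%E ->
    (N (fun x => (c * P x)%R) <= c%:E)%E.
  move=> c0 PX NP; rewrite (ri_homogeneous riN)// ger0_norm//.
  by rewrite -[leRHS]mule1 lee_wpmul2l.
have in_X (c : R) (P : T -> R) : in_space N P -> in_space N (fun x => c * P x).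
  move=> [mP NP]; split; first exact: measurable_funM.
  by rewrite (ri_homogeneous riN)// lte_mul_pinfty// (ri_ge0 riN).
apply: (@le_trans _ _ (N (fun x => th * Pf x + (1 - th) * Pg x))).
  apply: (ri_ideal riN).
  - by apply: meas_orlicz => //; exact: measurable_funD.
  - by apply: measurable_funD; exact: measurable_funM.
  apply: filterS2 ffin gfin => x fx gx.
  have fl0 : 0 <= `|f x| / l by rewrite divr_ge0// ltW.
  have gk0 : 0 <= `|g x| / k by rewrite divr_ge0// ltW.
  have fgk0 : 0 <= `|f x + g x| / (l + k) by rewrite divr_ge0// ltW.
  have Pf0 : 0 <= Pf x by rewrite fine_ge0// (orlicz_ge0 FO).
  have Pg0 : 0 <= Pg x by rewrite fine_ge0// (orlicz_ge0 FO).
  rewrite (orlicz_fine_norm FO)// (@ger0_norm _ (th * _ + _)); last first.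
    by apply: addr_ge0; apply: mulr_ge0.
  have := F_le x.
  rewrite -(orlicz_fineK FO _ fl0 fx) -(orlicz_fineK FO _ gk0 gx) -!EFinM -EFinD => Fx.
  by rewrite -lee_fin (orlicz_fineK FO)//; exact: le_lt_trans Fx (ltry _).
apply: le_trans (ri_triangle riN _ _) _; [exact: in_X | exact: in_X |].
apply: le_trans (leeD (homo_le _ _ _ _ _) (homo_le _ _ _ _ _)) _ => //.
by rewrite -EFinD addrC subrK.
Qed.

(* Fatou property of the Calderon-Lozanovskii space along sequences that are
   pointwise eventually constant; for those no left-continuity of [F] is needed. *)
Lemma admissible_fatou (fn : nat -> T -> R) (f : T -> R) (l : R) :
  fatou_property mu N -> (forall n, meas (fn n)) -> meas f ->
  {ae mu, forall x, (forall n, `|fn n x| <= `|fn n.+1 x|) /\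
                    exists n0, forall n, (n0 <= n)%N -> fn n x = f x} ->
  (forall n, admissible (fn n) l) -> admissible f l.
Proof.
move=> fatN mfn mf fnf admfn; have [l0 _] := admfn 0.
have fnfin : {ae mu, forall x, forall n, (F (`|fn n x| / l)%R < +oo)%E}.
  by apply: ae_foralln => n; have [_ []] := admfn n.
split => //; split.
  by apply: filterS2 fnf fnfin => x [_ [n0 fn0]] /(_ n0); rewrite fn0.
have [||||_ Ncvg] := fatN (fun n x => fine (F (`|fn n x| / l)%R))
  (fun x => fine (F (`|f x| / l)%R)).
- by move=> n; exact: meas_orlicz.
- exact: meas_orlicz.
- apply: filterS2 fnf fnfin => x [incr [n0 fn0]] fin; split.
    move=> n; have q0 : 0 <= `|fn n x| / l by rewrite divr_ge0// ltW.
    rewrite fine_ge0 ?(orlicz_ge0 FO)//=.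
    by apply: (orlicz_fine_le FO) => //; rewrite ler_pM2r// invr_gt0.
  by apply: cvg_near_cst; exists n0 => // n /= /fn0 ->.
- by exists 1 => n; have [_ []] := admfn n.
rewrite -(cvg_lim _ Ncvg)//; apply: lime_le; first by apply/cvg_ex; eexists; exact: Ncvg.
by apply: nearW => n; have [_ []] := admfn n.
Qed.

(** Provides the strictly positive element that serves as yardstick in the Egorov argument. *)
Lemma cl_weak_unit (b : R) : 0 < b -> (F b < +oo)%E ->
  exists (w : T -> R) (L : R), [/\ meas w, forall x, 0 <= w x,
    {ae mu, forall x, 0 < w x} & admissible w L].
Proof.
move=> b0 Fb; have [g [gX g0]] := ri_weak_unit riN; have [mg Ng] := gX.
(* The cap at 1 keeps [m x / L] in [[0, 1]], so convexity bounds [F (b * m x / L)] by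
   [m x / L * F b]. *)
pose m x := Num.min 1 `|g x|.
have m0 x : 0 <= m x by rewrite le_min ler01 normr_ge0.
have mm : meas m by apply: measurable_minr => //; exact: measurableT_comp.
pose c := fine (F b); pose M := fine (N g).
have c0 : 0 <= c by rewrite fine_ge0// (orlicz_ge0 FO)// ltW.
have NgE : N g = M%:E by rewrite /M fineK// ge0_fin_numE// (ri_ge0 riN).
have M0 : 0 <= M by rewrite fine_ge0// (ri_ge0 riN).
(* [L] exceeds [c * M], so [c / L * g], whose modulus dominates [F (w / L)], has norm at most 1. *)
pose L := 1 + c * M.
have L1 : 1 <= L by rewrite lerDl mulr_ge0.
have L0 : 0 < L by exact: lt_le_trans L1.
have mw : meas (fun x => b * m x) by exact: measurable_funM.
have F_le x : (F (`|b * m x| / L)%R <= (m x / L * c)%:E)%E.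
  have -> : `|b * m x| / L = m x / L * b.
      by rewrite ger0_norm ?mulr_ge0// ?(ltW b0)// (mulrC b) mulrAC.
    rewrite EFinM (orlicz_fineK FO)//; last exact: ltW.
  apply: (orlicz_shrink FO); first exact: ltW.
  rewrite divr_ge0 ?(ltW L0)//= ler_pdivrMr// mul1r.
  by apply: le_trans L1; rewrite ge_min lexx.
exists (fun x => b * m x), L; split => //.
- by move=> x; rewrite mulr_ge0// ltW.
- by apply: filterS g0 => x gx; rewrite mulr_gt0// lt_min ltr01 normr_gt0 gt_eqF.
- split => //; split.
    by apply: aeW => x; apply: le_lt_trans (F_le x) (ltry _).
  apply: (@le_trans _ _ (N (fun x => c / L * g x))).
    apply: (ri_ideal riN); first exact: meas_orlicz.
      exact: measurable_funM.
    apply: aeW => x.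
    have wL0 : 0 <= `|b * m x| / L by rewrite divr_ge0// ltW.
    rewrite (orlicz_fine_norm FO)// [leRHS]normrM (@ger0_norm _ (c / L)); last first.
      by rewrite divr_ge0// ltW.
    apply: (@le_trans _ _ (m x / L * c)).
      by rewrite -lee_fin (orlicz_fineK FO)//; exact: le_lt_trans (F_le x) (ltry _).
    have -> : m x / L * c = c / L * m x by rewrite mulrAC [RHS]mulrAC (mulrC c).
    by rewrite ler_wpM2l ?divr_ge0 ?(ltW L0)// ge_min lexx orbT.
  rewrite (ri_homogeneous riN)// NgE -EFinM lee_fin ger0_norm; last first.
    by rewrite divr_ge0// ltW.
  by rewrite mulrAC ler_pdivrMr// mul1r lerDr.
Qed.

End CalderonLozanovskii.

(** * Egorov's theorem from order continuity *)

Section Egorov.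
Context {R : realType} {d : measure_display} {T : measurableType d}
  {mu : {measure set T -> \bar R}} {N : (T -> R) -> \bar R}.
Hypotheses (riN : ri_space mu N) (ocN : order_continuous mu N)
  (fatN : fatou_property mu N).

Lemma indic_le (A B : set T) (x : T) : (A x -> B x) -> \1_A x <= \1_B x :> R.
Proof.
move=> AB; rewrite !indicE ler_nat; case: (boolP (x \in A)) => //.
by rewrite inE => /AB Bx; rewrite mem_set.
Qed.

Lemma indic_le1 (A : set T) (x : T) : \1_A x <= 1 :> R.
Proof. by rewrite indicE lern1 leq_b1. Qed.

(** Almost every point leaves the decreasing sets, so the restrictions of [|g|] decrease to 0 and
    order continuity applies. *)
Lemma oc_indic_small (g : T -> R) (A : nat -> set T) (e : R) :
  in_space N g -> (forall n, measurable (A n)) -> 0 < e ->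
  (forall n, A n.+1 `<=` A n) -> {ae mu, forall x, exists n, ~ A n x} ->
  exists n, (N (fun x => (`|g x| * \1_(A n) x)%R) <= e%:E)%E.
Proof.
move=> gX mA e0 Adec A0; have [mg _] := gX.
have Ncvg := ocN g (fun n x => `|g x| * \1_(A n) x) gX.
have {Ncvg}Ncvg : N (fun x => `|g x| * \1_(A n) x) @[n --> \oo] --> 0%E.
  apply: Ncvg.
    by move=> n; apply: meas_mul_indic => //; exact: measurableT_comp.
  apply: filterS A0 => x [n0 nA]; split.
    move=> n; rewrite mulr_ge0//= ler_piMr ?indic_le1//=.
    by rewrite ler_wpM2l// indic_le//; exact: Adec.
  apply: cvg_near_cst; exists n0 => // n /= n0n.
  rewrite indicE memNset ?mulr0// => An; apply: nA.
  have Amono k : A (n0 + k)%N x -> A n0 x.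
    by elim: k => [|k IH]; rewrite ?addn0// addnS => /Adec.
  by apply: (Amono (n - n0)%N); rewrite subnKC.
apply: contrapT => /forallNP H.
suff : (e%:E <= 0)%E by rewrite lee_fin leNgt e0.
rewrite -(cvg_lim _ Ncvg)//; apply: lime_ge; first by apply/cvg_ex; eexists; exact: Ncvg.
by apply: nearW => n; have /negP := H n; rewrite -ltNge => /ltW.
Qed.

(** Borel-Cantelli with the norm of [|g| * \1_A] in place of the measure of [A]: the upper limit of
    the sets [P i] has size 0, hence is null because [g] is positive. *)
Lemma oc_bigcap_tails_null (g : T -> R) (P : nat -> set T) :
  in_space N g -> {ae mu, forall x, 0 < g x} -> (forall n, measurable (P n)) ->
  (forall n, (N (fun x => (`|g x| * \1_(P n) x)%R) <= ((2^-1) ^+ n.+1)%:E)%E) ->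
  {ae mu, forall x, exists m, forall i, (m <= i)%N -> ~ P i x}.
Proof.
move=> gX g0 mP NP; have [mg _] := gX.
have mag : meas (fun x => `|g x|) by exact: measurableT_comp.
pose U m K := \bigcup_(i in [set i | (m <= i < m + K)%N]) P i.
have mU m K : measurable (U m K) by apply: bigcup_measurable.
have mgU m K : meas (fun x => `|g x| * \1_(U m K) x) by exact: meas_mul_indic.
have mgP n : meas (fun x => `|g x| * \1_(P n) x) by exact: meas_mul_indic.
(* Finite subadditivity; the right-hand side is the exact partial sum of the geometric series. *)
have NU m K : (N (fun x => (`|g x| * \1_(U m K) x)%R) <=
    ((2^-1) ^+ m - (2^-1) ^+ (m + K))%:E)%E.
  elim: K => [|K IH].
    rewrite addn0 subrr (_ : (fun x => _) = fun=> 0) ?(ri_norm0 riN)//.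
    apply/funext => x; rewrite indicE memNset ?mulr0//.
    by move=> [i /= /andP[mi]]; rewrite addn0 ltnNge mi.
  apply: (@le_trans _ _
      (N (fun x => `|g x| * \1_(U m K) x + `|g x| * \1_(P (m + K)%N) x))).
    apply: (ri_ideal riN); [exact: mgU | |].
      by apply: measurable_funD; [exact: mgU | exact: mgP].
    apply: aeW => x; rewrite -mulrDr !normrM ler_wpM2l//.
    rewrite !ger0_norm ?addr_ge0//.
    rewrite {1}indicE; case: (boolP (x \in U m K.+1)); last by rewrite /= addr_ge0.
    rewrite inE => -[i /= /andP[mi]]; rewrite addnS ltnS leq_eqVlt => /orP[/eqP ->|imK] Pix.
      by rewrite (indicE _ (P _)) mem_set// lerDr.
    by rewrite (indicE _ (U _ _)) mem_set ?lerDl//; exists i => //=; rewrite mi.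
  have inX (f : T -> R) (c : R) : meas f -> (N f <= c%:E)%E -> in_space N f.
    by move=> mf Nf; split => //; exact: le_lt_trans Nf (ltry _).
  apply: le_trans (ri_triangle riN (inX _ _ (mgU _ _) IH) (inX _ _ (mgP _) (NP _))) _.
  apply: le_trans (leeD IH (NP _)) _.
  rewrite -EFinD lee_fin addnS exprS.
  by set a := 2^-1 ^+ m; set b := 2^-1 ^+ _; lra.
pose B m := \bigcup_(i in [set i | (m <= i)%N]) P i.
have mB m : measurable (B m) by exact: bigcup_measurable.
(* The Fatou property carries the bound from finite unions to the countable union. *)
have NB m : (N (fun x => (`|g x| * \1_(B m) x)%R) <= ((2^-1) ^+ m)%:E)%E.
  have NU' K : (N (fun x => (`|g x| * \1_(U m K) x)%R) <= ((2^-1) ^+ m)%:E)%E.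
    by apply: le_trans (NU m K) _; rewrite lee_fin gerBl exprn_ge0.
  have [||||_ Ncvg] := fatN (fun K x => `|g x| * \1_(U m K) x)
    (fun x => `|g x| * \1_(B m) x).
  - exact: mgU.
  - exact: meas_mul_indic.
  - apply: aeW => x; split.
      move=> K; rewrite mulr_ge0//= ler_wpM2l// indic_le// => -[i /= /andP[mi iK] Pi].
      by exists i => //=; rewrite mi addnS ltnS ltnW.
    apply: cvg_near_cst; have [[i /= mi Pi]|nB] := pselect (B m x).
      exists i.+1 => // K /= iK; rewrite !indicE !mem_set//; first by exists i.
      by exists i => //=; rewrite mi (leq_trans iK)// leq_addl.
    exists 0%N => // K _; rewrite !indicE !memNset// => -[i /= /andP[mi iK] Pi].
    by apply: nB; exists i.
  - by exists ((2^-1) ^+ m).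
  rewrite -(cvg_lim _ Ncvg)//; apply: lime_le; first by apply/cvg_ex; eexists; exact: Ncvg.
  exact: nearW.
pose Binf := \bigcap_m B m.
have mBinf : measurable Binf by exact: bigcapT_measurable.
have mgB : meas (fun x => `|g x| * \1_Binf x) by exact: meas_mul_indic.
have NBinf m : (N (fun x => (`|g x| * \1_Binf x)%R) <= ((2^-1) ^+ m)%:E)%E.
  apply: le_trans (NB m); apply: (ri_ideal riN); [exact: mgB | exact: meas_mul_indic |].
  apply: aeW => x; rewrite !normrM ler_wpM2l// !ger0_norm// indic_le//; exact.
have NBinf0 : N (fun x => `|g x| * \1_Binf x) = 0%E.
  apply/eqP; rewrite eq_le (ri_ge0 riN) andbT.
  have half_cvg : ((2^-1 : R) ^+ n)%:E @[n --> \oo] --> 0%E.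
    by apply: cvg_EFin; [exact: nearW | apply: cvg_expr; rewrite ger0_norm//; lra].
  rewrite -(cvg_lim _ half_cvg)//; apply: lime_ge.
    by apply/cvg_ex; eexists; exact: half_cvg.
  exact: nearW.
have := ri_definite riN _ NBinf0; move=> /(_ (conj mgB _)).
rewrite NBinf0 => /(_ (ltry _)).
move=> gB0; apply: filterS2 g0 gB0 => x gx; rewrite indicE.
case: (boolP (x \in Binf)).
  by rewrite mulr1 => _ /eqP; rewrite normr_eq0 gt_eqF.
move=> /negP nB _; apply: contrapT => H; apply: nB; rewrite inE => m _.
apply: contrapT => nBm; apply: H; exists m => i mi Pi.
by apply: nBm; exists i.
Qed.

(* Egorov's theorem with no measure involved: the size of the exceptional
   sets is measured by the order continuous norm of a weak unit. *)
Lemma oc_egorov (u : nat -> T -> R) (w : T -> R) :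
  (forall n, meas (u n)) -> meas w -> {ae mu, forall x, 0 < w x} ->
  (forall n x, u n.+1 x <= u n x) -> (forall x, u ^~ x @ \oo --> 0) ->
  exists B : nat -> set T, [/\ forall m, measurable (B m),
    forall m k, (m <= k)%N -> B k `<=` B m,
    {ae mu, forall x, exists m, ~ B m x} &
    forall m i, (m <= i)%N ->
      exists n, forall x, ~ B m x -> u n x <= w x / i.+1%:R].
Proof.
move=> mu_ mw w0 udec u0; have [g [gX g0]] := ri_weak_unit riN.
(* The set where [u n] is not yet below [w / (i + 1)]; it shrinks with [n], and almost every point
   leaves it because [w] is positive there. *)
pose P i n := [set x | w x / i.+1%:R < u n x].
have mP i n : measurable (P i n).
  have mlt : measurable_fun setT (fun x => w x / i.+1%:R < u n x).
    by apply: measurable_fun_ltr; [exact: measurable_funM | exact: mu_].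
  by rewrite -[P i n]setTI; exact: (mlt measurableT [set true]).
have /choice[n_ NP] i : exists n,
    (N (fun x => (`|g x| * \1_(P i n) x)%R) <= ((2^-1) ^+ i.+1)%:E)%E.
  apply: oc_indic_small; [exact: gX | exact: mP | exact: exprn_gt0 | |].
    by move=> n x /= /lt_le_trans; exact.
  move: w0; apply: filterS => x wx.
  have wi : 0 < w x / i.+1%:R by rewrite divr_gt0.
  have /cvgr_lt/(_ _ wi)[n _ /(_ n)] := u0 x.
  by move=> /(_ (leqnn _)) /= un; exists n => /= /(lt_trans un); rewrite ltxx.
(* Outside the [m]-th tail union, [u (n_ i)] is at most [w / (i + 1)] for every [i >= m];
   Borel-Cantelli makes the intersection of these unions null. *)
exists (fun m => \bigcup_(i in [set i | (m <= i)%N]) P i (n_ i)); split.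
- by move=> m; exact: bigcup_measurable.
- by move=> m k mk x [i /= ki Pi]; exists i => //=; exact: leq_trans ki.
- have := oc_bigcap_tails_null g (fun i => P i (n_ i)) gX g0 (fun i => mP i (n_ i)) NP.
  by apply: filterS => x [m nP]; exists m => -[i /= mi]; exact: nP.
- move=> m i mi; exists (n_ i) => x nB; rewrite leNgt; apply/negP => Pi.
  by apply: nB; exists i.
Qed.

End Egorov.

(** * The gliding hump and the span of disjoint humps *)

Lemma infinitely_often_onto :
  exists p : nat -> nat, forall k m, exists2 j, (m <= j)%N & p j = k.
Proof.
(* The 2-adic valuation of [j + 1] takes the value [k] at [j + 1 = 2 ^ k * (2 * m + 1)], which lies
   beyond [m]. *)
exists (fun j => logn 2 j.+1) => k m.
have pos : (0 < 2 ^ k * m.*2.+1)%N by rewrite muln_gt0 expn_gt0.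
exists (2 ^ k * m.*2.+1).-1; last first.
  rewrite prednK// lognM ?expn_gt0// pfactorK//.
  by rewrite logn_coprime ?addn0// coprime2n /= odd_double.
rewrite -ltnS prednK//; apply: leq_trans (leq_pmull _ _); last by rewrite expn_gt0.
by rewrite ltnS -addnn leq_addr.
Qed.

Section Copy.
Context {R : realType} {d : measure_display} {T : measurableType d}
  {mu : {measure set T -> \bar R}} {N : (T -> R) -> \bar R} {F : R -> \bar R}.
Hypotheses (riN : ri_space mu N) (FO : orlicz F).

Local Notation adm := (@admissible R d T mu N F).

(** If [F] is infinite off 0, the space is trivial; this case is excluded before a positive element
    is built. *)
Lemma degenerate_admissible (f : T -> R) (l : R) :
  (forall b, 0 < b -> F b = +oo%E) -> adm f l -> {ae mu, forall x, f x = 0}.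
Proof.
move=> Foo [l0 [ffin _]]; apply: filterS ffin => x.
have [->//|fx] := eqVneq (f x) 0.
by rewrite Foo// divr_gt0// normr_gt0.
Qed.

(** Failure of admissibility encodes a lower bound for the norm, as admissible scalars are closed
    upwards. The [Q j] are selected among the Egorov sets. *)
Lemma hump_sets (G : nat -> T -> R) :
  order_continuous mu N -> fatou_property mu N ->
  (forall n, meas (G n)) -> (forall n x, 0 <= G n x) ->
  (forall n x, G n.+1 x <= G n x) -> (forall x, G ^~ x @ \oo --> 0) ->
  adm (G 0%N) 2 -> (forall n l, l < 1 -> ~ adm (G n) l) ->
  exists Q : nat -> set T, [/\ forall j, measurable (Q j),
    forall j, Q j.+1 `<=` Q j &
    forall j, ~ adm (fun x => G 0%N x * \1_(Q j `\` Q j.+1) x) (1 - j.+1%:R^-1)].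
Proof.
move=> ocN fatN mG G0 Gdec Gcvg adm2 nadm.
(* Otherwise admissibility at 2 would force [G 0 = 0] almost everywhere, and then 1/2 would be
   admissible too. *)
have [b b0 Fb] : exists2 b, 0 < b & (F b < +oo)%E.
  apply: contrapT => Foo; apply: (nadm 0%N 2^-1); first by rewrite invf_lt1 ?ltr1n.
  apply: (admissible_ae0 riN FO) => //.
  apply: degenerate_admissible adm2 => b b0; apply: contrapT => Fb.
  by apply: Foo; exists b => //; rewrite ltey; exact/eqP.
have [w [L [mw w0 wpos admw]]] := cl_weak_unit riN FO b b0 Fb.
have [B [mB Bdec Bnull Bsmall]] := oc_egorov riN ocN fatN G w mG mw wpos Gdec Gcvg.
have Gle n x : G n x <= G 0%N x.
  by elim: n => // n; exact: le_trans.
have L0 : 0 < L by have [] := admw.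
(* [G 0] keeps norm at least 1 on [B m]: some [G n] is dominated by the restriction of [G 0] to
   [B m] plus [w / (i + 1)], and for large [i] this sum would be admissible below 1. *)
have nadmB m l : l < 1 -> ~ adm (fun x => G 0%N x * \1_(B m) x) l.
  move=> l1 admB.
  have [i mi Li] : exists2 i, (m <= i)%N & l + L / i.+1%:R < 1.
    have [k /= kL] : exists k : nat, L / (1 - l) < k%:R.
      by exists (Num.bound (L / (1 - l))); apply: archi_boundP; rewrite divr_ge0 ?subr_ge0 ?(ltW L0) ?(ltW l1).
    exists (maxn m k); first exact: leq_maxl.
    rewrite addrC -ltrBrDr ltr_pdivrMr// mulrC -ltr_pdivrMr ?subr_gt0//.
    apply: lt_le_trans kL _; rewrite ler_nat; apply: leq_trans (leq_maxr m k) _; exact: leqnSn.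
  have [n Gn] := Bsmall m i mi.
  apply: (nadm n (l + L / i.+1%:R) Li).
  have mwi : meas (fun x => w x / i.+1%:R) by exact: measurable_funM.
  have mGB : meas (fun x => G 0%N x * \1_(B m) x) by exact: meas_mul_indic.
  have admwi : adm (fun x => w x / i.+1%:R) (L / i.+1%:R).
    apply: (admissible_le riN FO _ w L) => //; first exact: divr_gt0.
    apply: aeW => x; rewrite normrM (@ger0_norm _ (i.+1%:R^-1))// invf_div.
    by rewrite mulrA divfK.
  apply: (admissible_le riN FO _ _ _ _ (mG n) _ _ _ (admissibleD riN FO _ _ _ _ mGB mwi admB admwi)).
  - exact: measurable_funD.
  - by case: admB => l0 _; rewrite addr_gt0// divr_gt0.
  - apply: aeW => x; rewrite ler_wpM2r//.
      by rewrite invr_ge0 addr_ge0 ?divr_ge0 ?(ltW L0)//; case: admB => /ltW.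
    have wi0 : 0 <= w x / i.+1%:R by rewrite divr_ge0.
    rewrite !ger0_norm ?addr_ge0 ?mulr_ge0//.
    rewrite indicE; case: (boolP (x \in B m)) => xB.
      by rewrite mulr1 -[leLHS]addr0 lerD.
    by rewrite mulr0 add0r; apply: Gn => Bx; move: xB; rewrite mem_set.
(* As [k] grows, [B m \ B k] fills [B m] up to a null set; were [G 0] admissible at
   [1 - 1 / (j + 1)] on every such piece, it would be so on [B m] by the Fatou property. The pair
   holds the current index and the step number. *)
have /choice[nxt nxtP] (mj : nat * nat) : exists k, (mj.1 <= k)%N /\
    ~ adm (fun x => G 0%N x * \1_(B mj.1 `\` B k) x) (1 - mj.2.+1%:R^-1).
  case: mj => m j /=; apply: contrapT => H.
  apply: (nadmB m (1 - j.+1%:R^-1)); first by rewrite ltrBlDr ltrDl invr_gt0.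
  apply: (admissible_fatou FO (fun k x => G 0%N x * \1_(B m `\` B (m + k)%N) x) _ _ fatN).
  - by move=> k; apply: meas_mul_indic => //; exact: measurableD.
  - exact: meas_mul_indic.
  - apply: filterS Bnull => x [m0 nB]; split.
      move=> k; rewrite !normrM ler_wpM2l// !ger0_norm// indic_le// => -[Bm nBk].
      split=> // Bk; apply: nBk; apply: Bdec Bk; first by rewrite addnS.
    exists m0 => k m0k; congr (_ * _); rewrite !indicE; congr (_%:R); congr nat_of_bool.
    apply/idP/idP; rewrite !inE; first by case.
    by move=> Bm; split => // Bk; apply: nB; apply: Bdec Bk; rewrite (leq_trans m0k)// leq_addl.
  - move=> k; apply: contrapT => nadmk; apply: H; exists (m + k)%N; split => //.
    exact: leq_addr.
pose idx := fix idx j := if j is j'.+1 then nxt (idx j', j') else 0%N.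
exists (fun j => B (idx j)); split => //.
- by move=> j; apply: Bdec; have [] := nxtP (idx j, j).
- by move=> j; have [] := nxtP (idx j, j).
Qed.

Lemma linf_norm_bounded (a : nat -> R) : linf_bounded a ->
  exists2 M : R, linf_norm a = M%:E & forall n, `|a n| <= M.
Proof.
move=> [M aM].
have aS n : (`|a n|%:E <= linf_norm a)%E by apply: ereal_sup_ubound; exists n.
have fin : linf_norm a \is a fin_num.
  rewrite ge0_fin_numE; last by apply: le_trans (aS 0%N); rewrite lee_fin.
  apply: le_lt_trans (ltry M); apply: ge_ereal_sup => _ [n _ <-].
  by rewrite lee_fin.
exists (fine (linf_norm a)); first by rewrite fineK.
by move=> n; rewrite -lee_fin fineK.
Qed.

(** The embedding multiplies [h] by [a (p j)] on the [j]-th hump. The result is dominated by the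
    supremum of [|a|] times [h], and each coordinate of [a] occurs on infinitely many humps, where
    the norm of [h] tends to 1. *)
Lemma humps_span_linf (h : T -> R) (Q : nat -> set T) :
  meas h -> (forall x, 0 <= h x) -> (forall l, 1 < l -> adm h l) ->
  (forall j, measurable (Q j)) -> (forall j, Q j.+1 `<=` Q j) ->
  (forall j, ~ adm (fun x => h x * \1_(Q j `\` Q j.+1) x) (1 - j.+1%:R^-1)) ->
  contains_lattice_copy_linf mu (in_space (cl_norm mu N F)) (cl_norm mu N F).
Proof.
move=> mh h0 admh mQ Qdec nadm.
have [p p_onto] := infinitely_often_onto.
pose D j := Q j `\` Q j.+1.
have mD j : measurable (D j) by exact: measurableD.
have Qmono j k : (j <= k)%N -> Q k `<=` Q j.
  move=> /subnKC <-; elim: (k - j)%N => [|i IH]; first by rewrite addn0.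
  by rewrite addnS => x /Qdec /IH.
have Ddisj i j x : D i x -> D j x -> i = j.
  move=> [Qi nQi] [Qj nQj]; case: (ltngtP i j) => // ij; exfalso.
    by apply: nQi; exact: Qmono Qj.
  by apply: nQj; exact: Qmono Qi.
pose U := \bigcup_j D j.
have mU : measurable U by exact: bigcupT_measurable.
(* Index of the hump containing [x]; the default 0 off [U] is masked by the factor [\1_U] in [J]. *)
pose s x := xget 0%N [set j | D j x].
have sE j x : D j x -> s x = j.
  move=> Dj; apply: (Ddisj _ _ x _ Dj).
  by apply: (@xgetPex _ 0%N [set j | D j x]); exists j.
(* The default value puts the complement of [U] into the level set of 0. *)
have ms j : measurable [set x | s x = j].
  have -> : [set x | s x = j] = D j `|` (if j == 0%N then ~` U else set0).
    apply/seteqP; split=> [x /= sx|x /= [/sE//|]].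
      have [[i _ Di]|nU] := pselect (U x); first by left; rewrite -sx (sE i x Di).
      right; rewrite -sx /s xgetPN ?eqxx// => i Di; apply: nU; by exists i.
    case: eqP => // -> nU; rewrite /s xgetPN// => i Di; apply: nU; by exists i.
  by apply: measurableU => //; case: ifP => // _; exact: measurableC.
pose J (a : nat -> R) x := h x * \1_U x * a (p (s x)).
have mJ a : meas (J a).
  apply: measurable_funM; first exact: meas_mul_indic.
  move=> _ Y _; rewrite setTI.
  have -> : (fun x => a (p (s x))) @^-1` Y =
      \bigcup_(j in [set j | Y (a (p j))]) [set x | s x = j].
    by apply/seteqP; split=> [x Yx|x [j /= Yj sx]]; [exists (s x) | rewrite /preimage /= sx].
  exact: bigcup_measurable.
have hU0 x : 0 <= h x * \1_U x by rewrite mulr_ge0.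
exists J; split; last first.
  split; first by move=> a b _ _; apply: aeW => x; rewrite /J mulrDr.
  split; first by move=> c a _; apply: aeW => x; rewrite /J mulrCA.
  by move=> a b _ _; apply: aeW => x; rewrite /J maxr_pMr.
move=> a /linf_norm_bounded[M aME aM].
have M0 : 0 <= M by exact: le_trans (aM 0%N).
have JM : (cl_norm mu N F (J a) <= M%:E)%E.
  apply/lee_addgt0Pr => e e0; rewrite -EFinD; apply: admissible_cl_norm.
  have Me0 : 0 < M + e by rewrite ltr_wpDl.
  have M1 : 0 < M + 1 by rewrite ltr_wpDl.
  (* [h] is admissible at scalars above 1; the excess [e / (M + 1)] costs at most [e] after
     multiplication by [M], also when [M = 0]. *)
  have l0 : 0 < 1 + e / (M + 1) by rewrite addr_gt0// divr_gt0.
  apply: (admissible_le riN FO _ h (1 + e / (M + 1))) => //; last first.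
    by apply: admh; rewrite ltrDl divr_gt0.
  apply: aeW => x; rewrite ler_pdivrMr// mulrAC ler_pdivlMr//.
  apply: (@le_trans _ _ (`|h x| * M * (1 + e / (M + 1)))).
    rewrite ler_wpM2r ?(ltW l0)// normrM ler_pM// normrM ler_piMr//.
    by rewrite ger0_norm// indic_le1.
  rewrite -mulrA ler_wpM2l// mulrDr mulr1 lerD2l mulrCA ler_piMr ?(ltW e0)//.
  by rewrite ler_pdivrMr// mul1r lerDl.
split; first by split => //; exact: le_lt_trans JM (ltry _).
apply/eqP; rewrite eq_le aME JM /= -aME.
(* Lower bound: an admissible [r < |a n|] for [J a] would make [r / |a n|] admissible for [h] on
   every hump carrying the coordinate [n]. *)
apply: ge_ereal_sup => _ [n _ <-]; rewrite leNgt; apply/negP => /ereal_inf_lt.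
move=> [_ [r admr <-]]; rewrite lte_fin => ran.
have r0 : 0 < r by have [] := admr.
have an0 : 0 < `|a n| by exact: lt_trans ran.
have ran1 : r / `|a n| < 1 by rewrite ltr_pdivrMr// mul1r.
(* From hump number [m] on, [1 - 1 / (j + 1)] is at least [r / |a n|]. *)
pose m := Num.bound ((1 - r / `|a n|)^-1).
have [j mj pj] := p_onto n m.
have c_ge : r / `|a n| <= 1 - j.+1%:R^-1.
  rewrite lerBrDl -lerBrDr -[leRHS]invrK lef_pV2 ?posrE ?invr_gt0 ?subr_gt0//.
  have /ltW/le_trans : (1 - r / `|a n|)^-1 < m%:R.
    by apply: archi_boundP; rewrite invr_ge0 subr_ge0 ltW.
  by apply; rewrite ler_nat (leq_trans mj).
have c0 : 0 < 1 - j.+1%:R^-1 :> R by apply: lt_le_trans c_ge; exact: divr_gt0.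
apply: (nadm j).
apply: (admissible_le riN FO _ (J a) r) => //.
  by apply: meas_mul_indic => //; exact: measurableD.
apply: aeW => x; have [Dj|nD] := pselect (D j x); last first.
  by rewrite indicE memNset// mulr0 normr0 mul0r divr_ge0// ltW.
rewrite /J (sE j x Dj) pj !indicE !mem_set//; last by exists j.
rewrite !mulr1 normrM -mulrA ler_wpM2l// -[leRHS]invrK invf_div.
by rewrite lef_pV2 ?posrE ?divr_gt0.
Qed.

End Copy.

(** * From the Cesàro space to the Calderón-Lozanovskii space *)

Lemma linf_norm1 {R : realType} (a : nat -> R) (n : nat) :
  (forall k, `|a k| <= 1) -> a n = 1 -> linf_norm a = 1%E.
Proof.
move=> a1 an; apply/eqP; rewrite eq_le; apply/andP; split.
  by apply: ge_ereal_sup => _ [k _ <-]; rewrite lee_fin.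
by apply: ereal_sup_ubound; exists n => //; rewrite an normr1.
Qed.

Section Transfer.
Context {R : realType} {d : measure_display} {T : measurableType d}
  {mu : {measure set T -> \bar R}} {N : (T -> R) -> \bar R} {F : R -> \bar R}
  {Ces : (T -> R) -> T -> \bar R}.
Hypotheses (riN : ri_space mu N) (FO : orlicz F).
(** Two properties shared by both Cesàro operators: positivity, and additivity on moduli almost
    everywhere. *)
Hypothesis Ces_ge0 : forall f, meas f -> {ae mu, forall x, (0 <= Ces f x)%E}.
Hypothesis CesD : forall f g k : T -> R, meas f -> meas g -> meas k ->
  {ae mu, forall x, `|f x| = `|g x| + `|k x|} ->
  {ae mu, forall x, (Ces f x = Ces g x + Ces k x)%E}.

(* [c n] are the Cesaro transforms of the images of the tails [1_{k >= n}] and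
   [q n] those of the unit vectors. The decreasing sequence [c n] need not
   tend to [0], but subtracting its limit keeps it above [q n]. *)
Lemma decreasing_tails :
  contains_lattice_copy_linf mu (in_ces_space mu N F Ces) (ces_norm mu N F Ces) ->
  exists c q : nat -> T -> R, [/\ forall n, meas (c n), forall n, meas (q n),
    forall n, cl_norm mu N F (c n) = 1%E, forall n, cl_norm mu N F (q n) = 1%E &
    {ae mu, forall x, forall n, [/\ 0 <= c n x, 0 <= q n x &
      c n x = q n x + c n.+1 x]}].
Proof.
move=> [J [J_norm [JD [JZ Jmax]]]].
pose e (n k : nat) : R := (k == n)%:R; pose t (n k : nat) : R := (n <= k)%N%:R.
have bool_le1 (b : bool) : `|b%:R : R| <= 1 by rewrite normr_nat lern1 leq_b1.
have e_bnd n : linf_bounded (e n) by exists 1 => k; exact: bool_le1.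
have t_bnd n : linf_bounded (t n) by exists 1 => k; exact: bool_le1.
have e_norm n : linf_norm (e n) = 1%E.
  by apply: (linf_norm1 _ n) => [k|]; [exact: bool_le1 | rewrite /e eqxx].
have t_norm n : linf_norm (t n) = 1%E.
  by apply: (linf_norm1 _ n) => [k|]; [exact: bool_le1 | rewrite /t leqnn].
(* Positivity comes from the lattice property: [a] is the maximum of [a] and [0 * a], whose image
   vanishes by homogeneity. *)
have J_ge0 a : linf_bounded a -> (forall k, 0 <= a k) ->
    {ae mu, forall x, 0 <= J a x}.
  move=> a_bnd a0.
  have z_bnd : linf_bounded (fun k => 0 * a k) by exists 0 => k; rewrite mul0r normr0.
  apply: filterS2 (Jmax _ _ a_bnd z_bnd) (JZ 0 _ a_bnd) => x.
  have -> : (fun n => Num.max (a n) (0 * a n)) = a.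
    by apply/funext => k; rewrite mul0r max_l.
  by move=> -> ->; rewrite mul0r le_max lexx orbT.
have JS n : {ae mu, forall x, `|J (t n) x| = `|J (e n) x| + `|J (t n.+1) x|}.
  have tE : t n = (fun k => e n k + t n.+1 k).
    apply/funext => k; rewrite /t /e -natrD; congr (_%:R).
    by rewrite leq_eqVlt eq_sym; case: ltngtP.
  have t0 m : {ae mu, forall x, 0 <= J (t m) x} by apply: J_ge0.
  have e0 : {ae mu, forall x, 0 <= J (e n) x} by apply: J_ge0.
  have Jt := JD _ _ (e_bnd n) (t_bnd n.+1); rewrite -tE in Jt.
  apply: filterS2 Jt (filterI e0 (t0 n.+1)) => x -> [ex tx].
  by rewrite !ger0_norm// addr_ge0.
have Jt_in n : in_ces_space mu N F Ces (J (t n)) by have [] := J_norm _ (t_bnd n).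
have Je_in n : in_ces_space mu N F Ces (J (e n)) by have [] := J_norm _ (e_bnd n).
exists (fun n x => fine (Ces (J (t n)) x)), (fun n x => fine (Ces (J (e n)) x)); split.
- by move=> n; have [_ [_ []]] := Jt_in n.
- by move=> n; have [_ [_ []]] := Je_in n.
- by move=> n; have [_] := J_norm _ (t_bnd n); rewrite t_norm.
- by move=> n; have [_] := J_norm _ (e_bnd n); rewrite e_norm.
apply: ae_foralln => n.
have [mt [tfin _]] := Jt_in n.
have [mt' [t'fin _]] := Jt_in n.+1.
have [me [efin _]] := Je_in n.
have CesS := CesD _ _ _ mt me mt' (JS n).
apply: filterS2 (filterI (Ces_ge0 _ mt) (filterI (Ces_ge0 _ me) (Ces_ge0 _ mt')))
  (filterI CesS (filterI efin t'fin)) => x [t0 [e0 t'0]] [CS [ex t'x]].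
by rewrite !fine_ge0// CS fineD// ge0_fin_numE.
Qed.

Lemma cesaro_copy_transfer :
  order_continuous mu N -> fatou_property mu N ->
  contains_lattice_copy_linf mu (in_ces_space mu N F Ces) (ces_norm mu N F Ces) ->
  contains_lattice_copy_linf mu (in_space (cl_norm mu N F)) (cl_norm mu N F).
Proof.
move=> ocN fatN /decreasing_tails[c [q [mc mq c_norm q_norm [A [mA A0 cqA]]]]].
pose O := ~` A; have mO : measurable O by exact: measurableC.
have cqO x : O x -> forall n, [/\ 0 <= c n x, 0 <= q n x & c n x = q n x + c n.+1 x].
  by move=> Ox; apply: contrapT => nH; apply: Ox; exact: cqA.
have aeO : {ae mu, forall x, O x} by exists A; split => // x /= /contrapT.
(* Cutting off to the full set [O] makes monotonicity and convergence hold at every point. *)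
pose c' n x := c n x * \1_O x.
have mc' n : meas (c' n) by exact: meas_mul_indic.
have c'0 n x : 0 <= c' n x.
  rewrite /c' indicE; case: (boolP (x \in O)); last by rewrite mulr0.
  by rewrite inE mulr1 => /cqO/(_ n)[].
have c'S n x : c' n.+1 x <= c' n x.
  rewrite /c' indicE; case: (boolP (x \in O)); last by rewrite !mulr0.
  by rewrite inE !mulr1 => /cqO/(_ n)[_ q0 ->]; rewrite lerDr.
have c'dec x : {homo c'^~ x : n m / (n <= m)%N >-> m <= n}.
  by apply/nonincreasing_seqP => n; exact: c'S.
have c'cvg x : cvgn (c'^~ x).
  by apply: nonincreasing_is_cvgn => //; exists 0 => _ [n _ <-].
pose c_lim x := limn (c'^~ x).
have mc_lim : meas c_lim by apply: (measurable_fun_cvg mc') => x _; exact: c'cvg.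
have c_lim_le n x : c_lim x <= c' n x by exact: nonincreasing_cvgn_ge.
have c_lim0 x : 0 <= c_lim x by apply: limr_ge => //; exact: nearW.
pose G n x := c' n x - c_lim x.
have mG n : meas (G n) by apply: measurable_funB => //; exact: mc'.
have G0 n x : 0 <= G n x by rewrite subr_ge0.
have Gdec n x : G n.+1 x <= G n x by rewrite lerD2r.
have Gcvg x : G ^~ x @ \oo --> 0.
  by rewrite -(subrr (c_lim x)); apply: cvgB; [exact: c'cvg | exact: cvg_cst].
have admG l : 1 < l -> @admissible _ _ _ mu N F (G 0%N) l.
  move=> l1; have l0 : 0 < l by exact: lt_trans l1.
  have admc : @admissible _ _ _ mu N F (c 0%N) l.
    by apply: (cl_norm_lt_admissible riN FO) => //; rewrite c_norm lte_fin.
  apply: (admissible_le riN FO _ _ _ _ (mG _) (mc 0%N) l0 _ admc).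
  apply: filterS aeO => x Ox; rewrite ler_pM2r ?invr_gt0//.
  have [c0 _ _] := cqO x Ox 0%N; rewrite !ger0_norm//.
  by rewrite /G /c' indicE mem_set// mulr1 gerBl.
(* As [c_lim <= c (n + 1)] almost everywhere, [G n >= c n - c (n + 1) = q n], and [q n] has norm
   1. *)
have nadmG n l : l < 1 -> ~ @admissible _ _ _ mu N F (G n) l.
  move=> l1 adml; have [l0 _] := adml.
  have /(admissible_cl_norm) : @admissible _ _ _ mu N F (q n) l.
    apply: (admissible_le riN FO _ _ _ _ (mq n) (mG n) l0 _ adml).
    apply: filterS aeO => x Ox; rewrite ler_pM2r ?invr_gt0//.
    have [_ q0 cS] := cqO x Ox n; rewrite !ger0_norm//.
    have := c_lim_le n.+1 x.
    by rewrite /G /c' !indicE !mem_set// !mulr1 cS lerBrDr lerD2l.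
  by rewrite q_norm lee_fin leNgt l1.
have [|Q [mQ Qdec nadmQ]] := hump_sets riN FO G ocN fatN mG G0 Gdec Gcvg _ nadmG.
  by apply: admG; rewrite ltr1n.
exact: (humps_span_linf riN FO (G 0%N) Q).
Qed.

End Transfer.

(** * The Cesàro operators on intervals and on sequences *)

Section CesaroFunction.
Context {R : realType}.

Lemma leb_on_ae (I : set R) (mI : measurable I) (P : R -> Prop) :
  (forall x, I x -> P x) -> {ae (@leb_on R I), forall x, P x}.
Proof.
move=> IP; exists (~` I); split; first exact: measurableC.
  by rewrite /leb_on setICl measure0.
by move=> x nP Ix; apply: nP; exact: IP.
Qed.

Lemma ces_fun_ge0 (I : set R) (mI : measurable I) (f : R -> R) :
  (forall x, I x -> 0 < x) -> {ae (@leb_on R I), forall x, (0 <= ces_fun f x)%E}.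
Proof.
move=> Ipos; apply: leb_on_ae => // x /Ipos x0.
by rewrite mule_ge0 ?lee_fin ?invr_ge0 ?(ltW x0)// integral_ge0.
Qed.

(** The equality holds at every [x] in [I]: since []0, x]] lies in [I], the integrands over [[0, x]]
    agree off a null set. *)
Lemma ces_funD (I : set R) (mI : measurable I) (f g k : measurableTypeR R -> R) :
  (forall x, I x -> 0 < x) -> (forall x y, I x -> 0 < y <= x -> I y) ->
  meas f -> meas g -> meas k ->
  {ae (@leb_on R I), forall x, `|f x| = `|g x| + `|k x|} ->
  {ae (@leb_on R I), forall x, (ces_fun f x = ces_fun g x + ces_fun k x)%E}.
Proof.
move=> Ipos Idown mf mg mk [A [mA A0 fgkA]]; apply: leb_on_ae => // x Ix.
have x0 := Ipos x Ix.
have mabs (h : measurableTypeR R -> R) : meas h ->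
    measurable_fun `[0, x] (fun t => (`|h t|)%:E).
  move=> mh; apply/measurable_EFinP; apply: measurableT_comp => //.
  exact: measurable_funS mh.
rewrite /ces_fun -ge0_muleDr ?integral_ge0//; congr (_ * _)%E.
rewrite -ge0_integralD//; [|exact: mabs..].
apply: ge0_ae_eq_integral => //; [exact: mabs | by apply: emeasurable_funD; exact: mabs | |].
  by move=> t _; rewrite adde_ge0.
(* The endpoint 0 lies outside [I], where the hypothesis says nothing, so it joins the exceptional
   set. *)
exists ([set 0] `|` (A `&` I)); split.
- by apply: measurableU => //; exact: measurableI.
- apply/eqP; rewrite -measure_le0; apply: le_trans (measureU2 _ _ _) _ => //.
    exact: measurableI.
  rewrite -[leRHS]adde0; apply: leeD; rewrite le_eqVlt; apply/orP; left; apply/eqP.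
    exact: lebesgue_measure_set1.
  exact: A0.
- move=> t /= /not_implyP[]; rewrite in_itv /= => /andP[t0 tx] fgk.
  have [->|tn0] := eqVneq t 0; [by left | right].
  split; last by apply: (Idown x) => //; rewrite lt_neqAle eq_sym tn0 t0.
  by apply: fgkA => /= fgkE; apply: fgk; rewrite fgkE EFinD.
Qed.

Lemma thm45_ces_fun (I : set R) : measurable I -> (forall x, I x -> 0 < x) ->
  (forall x y, I x -> 0 < y <= x -> I y) -> thm45_for (leb_on I) (@ces_fun R).
Proof.
move=> mI Ipos Idown N F riN ocN fatN FO _.
(* [leb_on I] unfolds to the restriction [mrestr], which supplies the measure structure. *)
apply: (@cesaro_copy_transfer R _ _ (mrestr (@lebesgue_measure R) mI) N F (@ces_fun R)) => //.
  by move=> f _; exact: ces_fun_ge0.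
by move=> f g k; exact: ces_funD.
Qed.

End CesaroFunction.

(** A nonempty set contains a singleton, of counting measure 1, so null sets are empty. *)
Lemma counting_ae {R : realType} (P : nat -> Prop) :
  {ae (@counting nat R), forall n, P n} -> forall n, P n.
Proof.
move=> [A [mA A0 PA]] n; apply: contrapT => /PA An.
have : (@counting nat R [set n] <= @counting nat R A)%E.
  by apply: le_measure; rewrite ?inE// => _ ->.
by rewrite A0 /counting asboolT// fset_set1 finmap.cardfs1 lee_fin ler10.
Qed.

Theorem theorem4p5 (R : realType) :
  thm45_for (leb_on `]0%R, 1%R[) (@ces_fun R) /\
  thm45_for (leb_on `]0%R, +oo[) (@ces_fun R) /\
  thm45_for (@counting nat R) (@ces_seq R).
Proof.
split; [|split].
- apply: thm45_ces_fun => //= x; rewrite in_itv/=; first by case/andP.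
  by move=> y /andP[_ x1] /andP[y0 yx]; rewrite in_itv/= y0 (le_lt_trans yx).
- apply: thm45_ces_fun => //= x; rewrite in_itv/= andbT// => y _ /andP[y0 _].
  by rewrite in_itv/= y0.
- move=> N F riN ocN fatN FO _; apply: cesaro_copy_transfer => //.
    move=> f _; apply: aeW => n; rewrite lee_fin mulr_ge0 ?invr_ge0//.
    by rewrite sumr_ge0.
  (* Here the moduli add up at every index, so the finite averages split term by term. *)
  move=> f g k _ _ _ /counting_ae fgk; apply: aeW => n.
  rewrite /ces_seq -EFinD -mulrDr -big_split/=.
  by under eq_bigr do rewrite fgk.
Qed.
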